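(* Let $V=\{1,\dots,N\}$, $V^{\mathrm{abs}}=\{0,N+1\}$, $V^*=V\cup V^{\mathrm{abs}}$, and let $\{\eta(t),t\ge0\}$ be a consistent configuration process on $V^*$ with generator $\mathcal L^{\mathrm{abs}}=\mathcal L+\mathcal H$. Let $G(\eta,z)=\mathbb E_\eta[z^{\eta_0(\infty)}]$, $G^{\mathrm{irw}}(\eta,z)=\mathbb E^{\mathrm{irw}}_\eta[z^{\eta_0(\infty)}]$, and $\mathcal G(\eta,z):=G(\eta,z)-G^{\mathrm{irw}}(\eta,z)$ for $z\ge0$. Then for all $\mathbf x=(x_1,\dots,x_n)\in(V^* )^n$, $$\mathcal G(\phi(\mathbf x),z)=\sum_{\kappa=2}^nz^{n-\kappa}(1-z)^\kappa\sum_{1\le i_1<\dots<i_\kappa\le n}\mathcal G(\phi(x_{i_1},\dots,x_{i_\kappa}),0),$$ where $\mathcal G(\eta,0)=\mathbb P_\eta(\eta_0(\infty)=0)-\mathbb P^{\mathrm{irw}}_\eta(\eta_0(\infty)=0)$.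
   Context: Rates $r(i,j)\ge0$ for $i\in V$, $j\in\{0,N+1\}$. $\mathcal L$ generates a configuration process on $V$ (single-site space $\Lambda\subseteq\mathbb N_0$), acting only on $(\eta_i)_{i\in V}$; $\mathcal Hf(\eta)=\sum_{i\in V,j\in V^{\mathrm{abs}}}r(i,j)\eta_i[f(\eta-\delta_i+\delta_j)-f(\eta)]$. Consistency: $[\mathcal L^{\mathrm{abs}},\mathcal A]=0$, $\mathcal Af(\eta)=\sum_{x\in V^*}\eta_xf(\eta-\delta_x)$. $\phi(\mathbf y)=\sum_i\delta_{y_i}$. The associated random walk $X^{\mathrm{rw}}$ on $V^*$ is the single-particle motion: if $\eta(0)=\delta_u$ then $\eta(t)=\delta_{X^{\mathrm{rw}}(t)}$. The independent-walker process $\eta^{\mathrm{irw}}$ is the configuration process of $n$ independent copies of $X^{\mathrm{rw}}$ (for every $n$), with law $\mathbb P^{\mathrm{irw}}_\eta$ and expectation $\mathbb E^{\mathrm{irw}}_\eta$ when started from $\eta$. $\eta_0(\infty)$ is the number of particles eventually absorbed at $0$ (limit $t\to\infty$); $G(\eta,0):=\lim_{z\to0}G(\eta,z)$. *)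

(* Defs.v *)
From HB Require Import structures.
From mathcomp Require Import all_boot all_order all_algebra.
From mathcomp Require Import all_classical all_reals all_analysis.
Set Implicit Arguments. Unset Strict Implicit. Unset Printing Implicit Defensive.
Import Order.TTheory GRing.Theory Num.Theory.
Import numFieldNormedType.Exports.
Local Open Scope ring_scope.
Local Open Scope classical_set_scope.
Local Open Scope ring_scope.

Definition site (N : nat) := 'I_N.+2.
Definition bulk (N : nat) (i : site N) : bool := (0 < i < N.+1)%N.
Definition absb (N : nat) (i : site N) : bool := ~~ bulk i.

Definition config (N : nat) := {ffun site N -> nat}.
Definition total (N : nat) (eta : config N) : nat := (\sum_(i : site N) eta i)%N.

Definition delta (N : nat) (x : site N) : config N := [ffun y => nat_of_bool (y == x)].
Definition cfg_sub (N : nat) (eta : config N) (x : site N) : config N :=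
  [ffun y => (eta y - (y == x))%N].
Definition cfg_add (N : nat) (eta : config N) (x : site N) : config N :=
  [ffun y => (eta y + (y == x))%N].
Definition cfg_move (N : nat) (eta : config N) (i j : site N) : config N :=
  cfg_add (cfg_sub eta i) j.

Definition mass_configs (N m : nat) : seq (config N) :=
  map (fun f : {ffun 'I_N.+2 -> 'I_m.+1} => [ffun y => nat_of_ord (f y)] : config N)
    (enum [pred f : {ffun 'I_N.+2 -> 'I_m.+1}
            | (\sum_(y : 'I_N.+2) nat_of_ord (f y) == m)%N]).

Definition in_Omega (N : nat) (Lam : pred nat) (eta : config N) : Prop :=
  forall i : site N, bulk i -> Lam (eta i).

Definition gen (R : realType) (N : nat) (c : config N -> config N -> R)
  (f : config N -> R) (eta : config N) : R :=
  \sum_(xi <- mass_configs N (total eta)) c eta xi * (f xi - f eta).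

Definition annih (R : realType) (N : nat) (f : config N -> R) (eta : config N) : R :=
  \sum_(x : site N) (eta x)%:R * f (cfg_sub eta x).

Definition rates_H (R : realType) (N : nat) (r : site N -> site N -> R)
  (eta xi : config N) : R :=
  \sum_(i : site N | bulk i) \sum_(j : site N | absb j)
     r i j * (eta i)%:R * (xi == cfg_move eta i j)%:R.

Definition rates_abs (R : realType) (N : nat) (cL : config N -> config N -> R)
  (r : site N -> site N -> R) (eta xi : config N) : R :=
  cL eta xi + rates_H r eta xi.

(* Markov semigroup e^{t L} applied to f (finite state space per mass). *)
Definition semigroup (R : realType) (N : nat) (c : config N -> config N -> R)
  (t : R) (f : config N -> R) (eta : config N) : R :=
  limn (fun n => \sum_(k < n) t ^+ k / (k`!)%:R * iter k (gen c) f eta).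

(* Law of eta_0(infty) through t -> infty limits. *)
Definition Gfun (R : realType) (N : nat) (c : config N -> config N -> R)
  (eta : config N) (z : R) : R :=
  lim (semigroup c t (fun xi => z ^+ xi ord0) eta @[t --> +oo]).

Definition Pabs0 (R : realType) (N : nat) (c : config N -> config N -> R)
  (eta : config N) : R :=
  lim (semigroup c t (fun xi => (xi ord0 == 0%N)%:R) eta @[t --> +oo]).

Definition rw_rate (R : realType) (N : nat) (c : config N -> config N -> R)
  (u v : site N) : R := c (delta u) (delta v).

Definition rates_irw (R : realType) (N : nat) (c : config N -> config N -> R)
  (eta xi : config N) : R :=
  \sum_(u : site N) \sum_(v : site N | v != u)
     (eta u)%:R * rw_rate c u v * (xi == cfg_move eta u v)%:R.

Definition phi (N : nat) (s : seq (site N)) : config N := [ffun y => count_mem y s].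

Definition bulk_generator (R : realType) (N : nat) (Lam : pred nat)
  (cL : config N -> config N -> R) : Prop :=
  [/\
      forall eta xi, in_Omega Lam eta -> xi != eta -> 0 <= cL eta xi,
      forall eta xi, in_Omega Lam eta -> cL eta xi != 0 ->
        [/\ forall j, absb j -> xi j = eta j, total xi = total eta & in_Omega Lam xi] &
      forall eta eta' xi : config N, in_Omega Lam eta -> (forall i, bulk i -> eta i = eta' i) ->
        (forall j, absb j -> xi j = eta j) ->
        cL eta xi = cL eta' [ffun y => if bulk y then xi y else eta' y]].

Definition consistent (R : realType) (N : nat) (Lam : pred nat)
  (c : config N -> config N -> R) : Prop :=
  forall (f : config N -> R) (eta : config N), in_Omega Lam eta ->
    gen c (annih f) eta = annih (gen c f) eta.

(* Main.v *)
Require Import Defs.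
From HB Require Import structures.
From mathcomp Require Import all_boot all_order all_algebra.
From mathcomp Require Import all_classical all_reals all_analysis.
From mathcomp Require Import ring.
Import Order.TTheory GRing.Theory Num.Theory.
Import numFieldNormedType.Exports.
Local Open Scope ring_scope.
Set Implicit Arguments.
Unset Strict Implicit.
Unset Printing Implicit Defensive.

(** Let [A] be the annihilation operator and [g xi] the indicator of
    [xi ord0 = 0].  Expanding over the particles of [xi] the product of
    the factors [z + (1 - z) 1_(particle not at 0)], one gets for [n] particles
      [z ^ xi_0 = \sum_k z^(n-k) (1-z)^k / (n-k)! * (A^(n-k) g) xi],
    and [A^(n-k) f / (n-k)!] at [phi x] is the sum of [f] over the
    [k]-particle subconfigurations of [x].  Since the semigroup commutes with
    [A], both for the consistent process and for independent walkers, this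
    identity passes to the semigroups at time [t] and then to [t -> +oo].
    The terms [k = 0, 1] cancel because the two processes agree on at most one
    particle.  The limits exist because [g] is superharmonic (site [0] is
    absorbing), so that its evolution is nonnegative and nonincreasing in
    time; positivity and monotonicity are read off the Euler approximations
    [(1 + t L / n)^n] of [e^(tL)]. *)

(* [total] of Defs is shadowed by the totality predicate of ssrbool. *)
Local Notation total := Defs.total.

(** * Configurations of given mass and their labellings *)

Section Configurations.
Variable N : nat.
Implicit Types (eta xi : config N) (u v x y : site N).

Lemma mem_mass_configs (m : nat) xi : (xi \in mass_configs N m) = (total xi == m).
Proof.
apply/mapP/eqP => [[f fP ->]|xim].
  move: fP; rewrite mem_enum inE => /eqP fm; rewrite -[RHS]fm.
  by apply: eq_bigr => y _; rewrite ffunE.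
have le_m y : (xi y <= m)%N by rewrite -xim /total (bigD1 y) //= leq_addr.
exists [ffun y => inord (xi y)].
  rewrite mem_enum inE -xim; apply/eqP/eq_bigr => y _.
  by rewrite ffunE inordK // ltnS xim.
by apply/ffunP => y; rewrite !ffunE inordK // ltnS.
Qed.

Lemma mass_configs_uniq (m : nat) : uniq (mass_configs N m).
Proof.
rewrite map_inj_uniq ?enum_uniq // => f g /ffunP fg; apply/ffunP => y.
by apply: val_inj; have := fg y; rewrite !ffunE.
Qed.

Lemma big_mass_configs1 (R : pzRingType) (a : config N) (k : R) (h : config N -> R) :
  \sum_(xi <- mass_configs N (total a)) k * (xi == a)%:R * h xi = k * h a.
Proof.
rewrite (bigD1_seq a) /= ?mass_configs_uniq ?mem_mass_configs // eqxx mulr1.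
by rewrite big1 ?addr0 // => xi /negbTE ->; rewrite mulr0 mul0r.
Qed.

Lemma total_cfg_sub eta x : (0 < eta x)%N -> total (cfg_sub eta x) = (total eta).-1.
Proof.
move=> eta_x; rewrite /total (bigD1 x) // [in RHS](bigD1 x) //= ffunE eqxx.
rewrite (eq_bigr eta) => [|y /negbTE yx]; last by rewrite ffunE yx subn0.
by rewrite addnC addnBA // addnC subn1.
Qed.

Lemma total_cfg_add eta x : total (cfg_add eta x) = (total eta).+1.
Proof.
rewrite /total (bigD1 x) // [in RHS](bigD1 x) //= ffunE eqxx.
rewrite (eq_bigr eta) => [|y /negbTE yx]; last by rewrite ffunE yx addn0.
by rewrite addn1 addSn.
Qed.

Lemma total_cfg_move eta u v : (0 < eta u)%N -> total (cfg_move eta u v) = total eta.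
Proof.
move=> eta_u; rewrite total_cfg_add total_cfg_sub // prednK //.
by rewrite /total (bigD1 u) //= ltn_addr.
Qed.

Lemma cfg_subC eta x y : cfg_sub (cfg_sub eta x) y = cfg_sub (cfg_sub eta y) x.
Proof. by apply/ffunP => i; rewrite !ffunE subnAC. Qed.

Lemma cfg_move_delta u v : cfg_move (delta u) u v = delta v.
Proof. by apply/ffunP => i; rewrite !ffunE subnn. Qed.

Lemma total_phi (s : seq (site N)) : total (phi s) = size s.
Proof.
transitivity (\sum_(y : site N) \sum_(i <- s | y == i) 1)%N.
  apply: eq_bigr => y _; rewrite ffunE sum1_count.
  by apply: eq_count => i; rewrite eq_sym.
rewrite (exchange_big_dep xpredT) //= -sum1_size; apply: eq_bigr => i _.
by rewrite (big_pred1 i).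
Qed.

(** Listing each site as often as it is occupied gives a labelling. Identities proved for labelled
    particles thereby extend to all configurations of the same mass. *)
Lemma phi_surj eta : exists x : (total eta).-tuple (site N), phi x = eta.
Proof.
pose s := flatten [seq nseq (eta i) i | i <- enum (site N)].
have phis : phi s = eta.
  apply/ffunP => y; rewrite ffunE count_flatten -map_comp sumnE big_map.
  rewrite big_enum /= (bigD1 y) //= count_nseq /= eqxx mul1n.
  by rewrite big1 ?addn0 // => i /negbTE iy; rewrite count_nseq /= iy.
have ss : size s == total eta by rewrite -phis total_phi.
by exists (Tuple ss).
Qed.

End Configurations.

(** * Annihilation as a sum over subsets of labels *)

Section Labelled.
Variables (R : realType) (N n : nat).
Implicit Types (f : config N -> R) (x : n.-tuple (site N)) (S : {set 'I_n}).

Lemma phi_subsetE x S (y : site N) :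
  phi [seq tnth x i | i <- enum S] y = (\sum_(i in S) (tnth x i == y))%N.
Proof.
rewrite ffunE count_map -sum1_count big_enum_cond big_mkcondr /=.
by apply: eq_bigr => i _; case: (_ == _).
Qed.

Lemma phi_setT x : phi [seq tnth x i | i <- enum [set: 'I_n]] = phi x.
Proof. by rewrite enum_setT -enumT map_tnth_enum. Qed.

Lemma cfg_sub_phi x S i : i \in S ->
  cfg_sub (phi [seq tnth x j | j <- enum S]) (tnth x i)
  = phi [seq tnth x j | j <- enum (S :\ i)].
Proof.
move=> iS; apply/ffunP => y.
by rewrite ffunE !phi_subsetE (big_setD1 i iS) /= [y == _]eq_sym addKn.
Qed.

(** The weight of a site is the number of labels of [S] placed there, so the weighted sum over sites
    is a sum over labels. *)
Lemma annih_phi f x S :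
  annih f (phi [seq tnth x i | i <- enum S])
  = \sum_(i in S) f (phi [seq tnth x j | j <- enum (S :\ i)]).
Proof.
set eta := phi _.
transitivity (\sum_(y : site N) \sum_(i in S)
    (tnth x i == y)%:R * f (cfg_sub eta y)).
  by apply: eq_bigr => y _; rewrite {1}/eta phi_subsetE natr_sum mulr_suml.
rewrite exchange_big /=; apply: eq_bigr => i iS.
rewrite (bigD1 (tnth x i)) //= eqxx mul1r cfg_sub_phi // big1 ?addr0 // => y.
by rewrite eq_sym => /negbTE ->; rewrite mul0r.
Qed.

(** Double counting: a set of size [m] arises as [S :\ i] once for each of the [n - m] labels [i]
    outside it. *)
Lemma sum_setD1 (m : nat) (F : {set 'I_n} -> R) :
  \sum_(S : {set 'I_n} | #|S| == m.+1) \sum_(i in S) F (S :\ i)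
  = (n - m)%:R * \sum_(S : {set 'I_n} | #|S| == m) F S.
Proof.
rewrite (exchange_big_dep xpredT) //=.
transitivity (\sum_(i < n) \sum_(S : {set 'I_n} | (#|S| == m) && (i \notin S)) F S).
  apply: eq_bigr => i _.
  rewrite (reindex_onto (fun S => i |: S) (fun S => S :\ i)) /=; last first.
    by move=> S /andP[_ iS]; rewrite finset.setD1K.
  apply: eq_big => [S|S /andP[_ /eqP ->] //].
  rewrite finset.setU11 andbT; apply/andP/andP.
    move=> [cS /eqP SE]; have iS : i \notin S by rewrite -SE !inE eqxx.
    by move: cS; rewrite cardsU1 iS add1n eqSS.
  by move=> [/eqP cS iS]; rewrite cardsU1 iS cS finset.setU1K.
rewrite (exchange_big_dep (fun S : {set 'I_n} => #|S| == m)) /=; last by move=> ? ? _ /andP[].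
rewrite mulr_sumr; apply: eq_bigr => S /eqP cS.
rewrite sumr_const -[LHS]mulr_natl; congr (_%:R * _).
have nE : (#|S| + #|~: S| = n)%N by rewrite cardsC card_ord.
rewrite -cS -[X in (X - _)%N]nE addKn.
by apply: eq_card => i; rewrite !inE unfold_in cS eqxx.
Qed.

(** The [k] particles can be removed in any order, so each set of [n - k] survivors is reached [k!]
    times. *)
Lemma iter_annih f x (k : nat) : (k <= n)%N ->
  iter k (@annih R N) f (phi x)
  = k`!%:R * \sum_(S : {set 'I_n} | #|S| == (n - k)%N)
                f (phi [seq tnth x i | i <- enum S]).
Proof.
elim: k f => [|k IHk] f kn.
  rewrite subn0 mul1r (big_pred1 [set: 'I_n]) ?phi_setT // => S.
  apply/eqP/eqP => [cS|->]; last by rewrite cardsT card_ord.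
  by apply/eqP; rewrite eqEcard finset.subsetT cardsT card_ord cS /=.
rewrite iterSr IHk ?(ltnW kn) //.
under eq_bigr do rewrite annih_phi.
have -> : (n - k = (n - k.+1).+1)%N by rewrite subnSK.
rewrite (sum_setD1 _ (fun S => f (phi [seq tnth x j | j <- enum S]))).
by rewrite mulrA -natrM subKn // factS mulnC.
Qed.

(** A particle contributes the factor [z] at site 0 and 1 elsewhere, that is, [(1 - z)] times the
    indicator of being elsewhere, plus [z]. The product of these sums is expanded over the set [S]
    of labels taking the first summand. *)
Lemma exp_phi0 x (z : R) :
  z ^+ phi x ord0 = \sum_(k < n.+1) z ^+ (n - k) * (1 - z) ^+ k *
    \sum_(S : {set 'I_n} | #|S| == k)
       (phi [seq tnth x i | i <- enum S] ord0 == 0%N)%:R.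
Proof.
transitivity (\prod_(i < n) ((1 - z) * (tnth x i != ord0)%:R + z)).
  rewrite -phi_setT phi_subsetE expr_sum big_mkcond /=.
  apply: eq_bigr => i _; rewrite inE.
  by case: (_ == _); rewrite ?mulr0 ?add0r ?mulr1 ?subrK ?expr0 ?expr1.
rewrite bigA_distr /=.
transitivity (\sum_(S : {set 'I_n}) z ^+ (n - #|S|) * (1 - z) ^+ #|S| *
   (phi [seq tnth x i | i <- enum S] ord0 == 0%N)%:R).
  apply: eq_bigr => S _; rewrite phi_subsetE.
  rewrite (bigID (mem S)) /= (eq_bigr (fun i => (1 - z) * (tnth x i != ord0)%:R));
    last by move=> i ->.
  rewrite [X in _ * X](eq_bigr (fun => z)); last by move=> i /negbTE ->.
  rewrite big_split /= !prodr_const [LHS]mulrC -[RHS]mulrA; congr (_ ^+ _ * (_ * _)).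
    have nE : (#|S| + #|~: S| = n)%N by rewrite cardsC card_ord.
    rewrite -[X in (X - _)%N]nE addKn.
    by apply: eq_card => i; rewrite !inE.
  (* If some particle of [S] sits at 0, both sides vanish; otherwise all indicators are 1. *)
  case: (boolP [exists i in S, tnth x i == ord0]) => [/exists_inP[i iS xi]|].
    by rewrite (bigD1 i) //= [in RHS](bigD1 i) //= xi mul0r.
  rewrite negb_exists_in => /forall_inP xS.
  by rewrite !big1 // => i iS; have := xS i iS; case: (_ == _).
(* Subsets are grouped by cardinality; [inord] is faithful here since a subset has at most [n]
   elements. *)
rewrite (partition_big (fun S : {set 'I_n} => inord #|S| : 'I_n.+1) xpredT) //=.
apply: eq_bigr => k _; rewrite mulr_sumr; apply: eq_big => S.
  rewrite -val_eqE /= inordK // ltnS -[X in (_ <= X)%N]card_ord; exact: max_card.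
move=> /eqP <-; rewrite inordK // ltnS -[X in (_ <= X)%N]card_ord; exact: max_card.
Qed.

End Labelled.

(** * Exponential series as limits of Euler approximations *)

Section ExponentialSeries.
Variable R : realType.
Local Open Scope classical_set_scope.

Lemma cvg_bigsum (T I : Type) (F : set_system T) (FF : Filter F) (r : seq I)
    (P : pred I) (f : I -> T -> R) (l : I -> R) :
  (forall i, P i -> f i @ F --> l i) ->
  (fun t => \sum_(i <- r | P i) f i t) @ F --> \sum_(i <- r | P i) l i.
Proof. by move=> fl; apply: cvg_big => //; exact: add_continuous. Qed.

(** With [y = x / (n + 1)], the bounds [exp (y / (1 + y)) <= 1 + y <= exp y] are raised to the power
    [n + 1] and squeezed. *)
Lemma cvg_compound_expR (x : R) : 0 <= x ->
  (fun n => (1 + x / n.+1%:R) ^+ n.+1) @ \oo --> expR x.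
Proof.
move=> x0; pose y n := x / n.+1%:R : R.
have y0 n : 0 <= y n by rewrite divr_ge0.
have ny n : n.+1%:R * y n = x by rewrite mulrC divfK // pnatr_eq0.
apply: (@squeeze_cvgr _ _ _ _ (fun n => expR (x / (1 + y n))) (fun=> expR x)).
- near=> n; apply/andP; split.
  + have -> : x / (1 + y n) = n.+1%:R * (y n / (1 + y n)) by rewrite mulrA ny.
    rewrite expRM_natl lerXn2r ?nnegrE ?expR_ge0 ?addr_ge0 ?y0 //.
    have y1 : 0 < 1 + y n by rewrite ltr_pwDl.
    (* After inversion the lower bound reads [1 / (1 + y) <= exp (- y / (1 + y))], an instance of
       [1 + w <= exp w]. *)
    rewrite -[y n / _]opprK expRN -[leRHS]invrK lef_pV2 ?posrE ?expR_gt0 ?invr_gt0 //.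
    apply: le_trans (expR_ge1Dx _).
    suff -> : 1 + - (y n / (1 + y n)) = (1 + y n)^-1 by [].
    by field; rewrite lt0r_neq0.
  + rewrite -[X in expR X](ny n) expRM_natl lerXn2r ?nnegrE ?expR_ge0 ?addr_ge0 ?y0 //.
    exact: expR_ge1Dx.
- have -> : expR x = expR (x / (1 + x * 0)) by rewrite mulr0 addr0 divr1.
  apply: continuous_cvg; first exact: continuous_expR.
  apply: cvgM; first exact: cvg_cst.
  apply: cvgV; first by rewrite mulr0 addr0 oner_neq0.
  apply: cvgD; first exact: cvg_cst.
  by apply: cvgM; [exact: cvg_cst|exact: cvg_harmonic].
- exact: cvg_cst.
Unshelve. all: by end_near. Qed.

Lemma ffact_leq_exp (n m : nat) : (n ^_ m <= n ^ m)%N.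
Proof.
elim: m => // m IHm; rewrite ffactnSr expnSr leq_mul //; exact: leq_subr.
Qed.

(** A falling factorial is at most the corresponding power. This fixes the sign of each coefficient
    in the error of the Euler scheme. *)
Lemma bin_div_exp_le (n k : nat) : 'C(n.+1, k)%:R / n.+1%:R ^+ k <= k`!%:R^-1 :> R.
Proof.
have k0 : 0 < k`!%:R :> R by rewrite ltr0n fact_gt0.
rewrite ler_pdivrMr ?exprn_gt0 // mulrC ler_pdivlMr //.
by rewrite -natrM -natrX ler_nat bin_ffact ffact_leq_exp.
Qed.

Variables (a : nat -> R) (C M t : R).
Hypothesis aC : forall k, `|a k| <= C ^+ k * M.
Hypotheses (C0 : 0 <= C) (M0 : 0 <= M).

(** Termwise domination by [M] times the exponential series of [|t| * C]. In the application [a k]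
    is the value of the [k]-th iterate of the generator at a configuration. *)
Lemma is_cvg_exp_series : cvgn (fun n => \sum_(k < n) t ^+ k / k`!%:R * a k).
Proof.
have -> : (fun n => \sum_(k < n) t ^+ k / k`!%:R * a k) =
    series (fun k => t ^+ k / k`!%:R * a k).
  by apply/funext => n; rewrite /series /= big_mkord.
apply: normed_cvg.
apply: (@series_le_cvg _ _ (M *: exp_coeff (`|t| * C))) => [n|n|n|].
- exact: normr_ge0.
- by apply: mulr_ge0 => //; exact/exp_coeff_ge0/mulr_ge0.
- rewrite [leRHS](_ : _ = `|t| ^+ n / n`!%:R * (C ^+ n * M)); last first.
    rewrite [LHS](_ : _ = M * ((`|t| * C) ^+ n / n`!%:R)) // exprMn; ring.
  rewrite [leLHS](_ : _ = `|t ^+ n / n`!%:R * a n|) // normrM normrM normrX normfV normr_nat.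
  by rewrite ler_wpM2l // divr_ge0 // exprn_ge0.
- exact/is_cvg_seriesZ/is_cvg_series_exp_coeff.
Qed.

(* The error is dominated termwise by that of [(1 + C t / n) ^ n] against [expR (C t)]. *)
Lemma cvg_compound_exp_series : 0 <= t ->
  (fun n => \sum_(k < n.+2) 'C(n.+1, k)%:R * (t / n.+1%:R) ^+ k * a k) @ \oo -->
  limn (fun n => \sum_(k < n) t ^+ k / k`!%:R * a k).
Proof.
move=> t0.
pose u n : R := \sum_(k < n) t ^+ k / k`!%:R * a k.
pose v n : R := \sum_(k < n.+2) 'C(n.+1, k)%:R * (t / n.+1%:R) ^+ k * a k.
pose e n : R := M * (series (exp_coeff (C * t)) n.+2 - (1 + C * t / n.+1%:R) ^+ n.+1).
have Ct0 : 0 <= C * t by rewrite mulr_ge0.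
have e0 : e @ \oo --> 0.
  rewrite -(mulr0 M) -(subrr (expR (C * t))).
  apply: cvgM; first exact: cvg_cst.
  apply: cvgB; last exact: cvg_compound_expR.
  have /cvg_ex[l ul] := @is_cvg_series_exp_coeff R (C * t).
  rewrite /expR (cvg_lim _ ul) //.
  by have := ul; rewrite -(cvg_shiftn 2); under eq_fun do rewrite addn2.
(* The sum [v n] has [n + 2] terms, hence the comparison with [u n.+2] and the shifts by two in the
   limits. *)
have uv n : `|v n - u n.+2| <= e n.
  rewrite /v /u /e -sumrB; apply: (le_trans (ler_norm_sum _ _ _)).
  rewrite /series /= big_mkord exprDn -sumrB mulr_sumr; apply: ler_sum => k _.
  rewrite expr1n mul1r /exp_coeff /= -mulrBl normrM.
  have -> : 'C(n.+1, k)%:R * (t / n.+1%:R) ^+ k - t ^+ k / k`!%:R =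
     - (t ^+ k * (k`!%:R^-1 - 'C(n.+1, k)%:R / n.+1%:R ^+ k)).
    by rewrite expr_div_n; ring.
  rewrite normrN normrM (ger0_norm (exprn_ge0 _ t0)).
  rewrite ger0_norm ?subr_ge0 ?bin_div_exp_le //.
  have -> : M * ((C * t) ^+ k / k`!%:R - (C * t / n.+1%:R) ^+ k *+ 'C(n.+1, k)) =
    t ^+ k * (k`!%:R^-1 - 'C(n.+1, k)%:R / n.+1%:R ^+ k) * (C ^+ k * M).
    by rewrite -mulr_natl expr_div_n exprMn; ring.
  by rewrite ler_wpM2l // mulr_ge0 ?exprn_ge0 // subr_ge0 bin_div_exp_le.
have vu : (fun n => v n - u n.+2) @ \oo --> 0.
  apply: (@squeeze_cvgr _ _ _ _ (fun n => - e n) e) => //.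
    by near=> n; rewrite -ler_norml.
  by rewrite -oppr0; exact: cvgN.
have u2 : (fun n => u n.+2) @ \oo --> limn u.
  have := is_cvg_exp_series; rewrite -/u => cu.
  by have := cu : u @ \oo --> limn u; rewrite -(cvg_shiftn 2); under eq_fun do rewrite addn2.
rewrite -/u -/v -[limn u]add0r.
have -> : v = (fun n => v n - u n.+2) \+ (fun n => u n.+2).
  by apply/funext => n; rewrite /= subrK.
exact: cvgD.
Unshelve. all: by end_near. Qed.

End ExponentialSeries.

(** * The generator at fixed mass, its semigroup and its Euler scheme *)

Section Generator.
Variables (R : realType) (N : nat) (c : config N -> config N -> R).
Implicit Types (f g : config N -> R) (eta xi : config N).

(** The sum in [gen] runs over configurations of the mass of [eta], so each mass is a separate
    finite system. *)
Lemma eq_gen f g eta :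
  (forall xi, total xi = total eta -> f xi = g xi) -> gen c f eta = gen c g eta.
Proof.
move=> fg; apply: eq_big_seq => xi; rewrite mem_mass_configs => /eqP xim.
by rewrite !fg.
Qed.

Lemma eq_iter_gen f g (k m : nat) :
  (forall xi, total xi = m -> f xi = g xi) ->
  forall eta, total eta = m -> iter k (gen c) f eta = iter k (gen c) g eta.
Proof.
move=> fg; elim: k => [|k IHk] eta etam; first exact: fg.
by apply: eq_gen => xi xim; apply: IHk; rewrite xim.
Qed.

Lemma eq_semigroup f g (t : R) eta :
  (forall xi, total xi = total eta -> f xi = g xi) ->
  semigroup c t f eta = semigroup c t g eta.
Proof.
move=> fg; rewrite /semigroup; under eq_fun do under eq_bigr do
  rewrite (eq_iter_gen _ fg) //.
by [].
Qed.

Lemma gen_sum (I : Type) (s : seq I) (P : pred I) (b : I -> R) (F : I -> config N -> R) eta :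
  gen c (fun xi => \sum_(i <- s | P i) b i * F i xi) eta
  = \sum_(i <- s | P i) b i * gen c (F i) eta.
Proof.
rewrite /gen; under eq_bigr do rewrite -sumrB mulr_sumr.
rewrite exchange_big /=; apply: eq_bigr => i _; rewrite mulr_sumr.
by apply: eq_bigr => xi _; ring.
Qed.

Lemma iter_gen_sum (k : nat) (I : Type) (s : seq I) (P : pred I) (b : I -> R)
    (F : I -> config N -> R) eta :
  iter k (gen c) (fun xi => \sum_(i <- s | P i) b i * F i xi) eta
  = \sum_(i <- s | P i) b i * iter k (gen c) (F i) eta.
Proof.
elim: k eta => // k IHk eta; rewrite !iterS -gen_sum.
by apply: eq_gen => xi _.
Qed.

(** A crude bound on the sup norm of the generator at mass [m]: the factor 2 comes from the
    difference [f xi - f eta], and summing over [eta] makes it uniform. *)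
Definition rate_bound (m : nat) : R :=
  2 * \sum_(eta <- mass_configs N m) \sum_(xi <- mass_configs N m) `|c eta xi|.

Lemma rate_bound_ge0 m : 0 <= rate_bound m.
Proof. by rewrite mulr_ge0 // !sumr_ge0 // => eta _; rewrite sumr_ge0. Qed.

Lemma sum_rate_le eta :
  2 * \sum_(xi <- mass_configs N (total eta)) `|c eta xi| <= rate_bound (total eta).
Proof.
rewrite ler_wpM2l //.
rewrite [leRHS](bigD1_seq eta) ?mem_mass_configs ?mass_configs_uniq //=.
by rewrite lerDl sumr_ge0 // => xi _; rewrite sumr_ge0.
Qed.

Lemma norm_gen_le f (m : nat) (M : R) :
  (forall xi, total xi = m -> `|f xi| <= M) ->
  forall eta, total eta = m -> `|gen c f eta| <= rate_bound m * M.
Proof.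
move=> fM eta etam; have M0 : 0 <= M by apply: le_trans (fM _ etam).
apply: le_trans (ler_norm_sum _ _ _) _.
apply: (@le_trans _ _ (2 * (\sum_(xi <- mass_configs N m) `|c eta xi|) * M)); last first.
  by rewrite ler_wpM2r // -etam sum_rate_le.
rewrite mulrAC mulr_sumr etam big_seq [leRHS]big_seq; apply: ler_sum => xi.
rewrite mem_mass_configs => /eqP xim.
rewrite normrM mulrC ler_wpM2r // (le_trans (ler_normB _ _)) //.
by rewrite mulr2n mulrDl mul1r lerD // fM.
Qed.

Lemma norm_iter_gen_le f (k m : nat) (M : R) :
  (forall xi, total xi = m -> `|f xi| <= M) ->
  forall eta, total eta = m -> `|iter k (gen c) f eta| <= rate_bound m ^+ k * M.
Proof.
move=> fM; elim: k => [|k IHk] eta etam; first by rewrite mul1r fM.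
by rewrite exprS -mulrA iterS (norm_gen_le IHk).
Qed.

Lemma iter_gen_bounded f eta : exists2 M : R, 0 <= M &
  forall k, `|iter k (gen c) f eta| <= rate_bound (total eta) ^+ k * M.
Proof.
pose M : R := \sum_(xi <- mass_configs N (total eta)) `|f xi|.
exists M => [|k]; first by rewrite sumr_ge0.
apply: norm_iter_gen_le => // xi xim.
rewrite /M (bigD1_seq xi) ?mem_mass_configs ?xim ?mass_configs_uniq //=.
by rewrite lerDl sumr_ge0.
Qed.

Lemma is_cvg_semigroup f (t : R) eta :
  cvgn (fun n => \sum_(k < n) t ^+ k / (k`!)%:R * iter k (gen c) f eta).
Proof.
have [M M0 fM] := iter_gen_bounded f eta.
exact: is_cvg_exp_series fM (rate_bound_ge0 _) M0.
Qed.

Lemma semigroup_sum (I : Type) (s : seq I) (P : pred I) (b : I -> R)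
    (F : I -> config N -> R) (t : R) eta :
  semigroup c t (fun xi => \sum_(i <- s | P i) b i * F i xi) eta
  = \sum_(i <- s | P i) b i * semigroup c t (F i) eta.
Proof.
apply: cvg_lim => //.
rewrite (_ : (fun n => _) = fun n => \sum_(i <- s | P i)
    \sum_(k < n) t ^+ k / (k`!)%:R * (b i * iter k (gen c) (F i) eta)); last first.
  apply/funext => n; rewrite exchange_big /=; apply: eq_bigr => k _.
  by rewrite iter_gen_sum mulr_sumr.
apply: cvg_bigsum => i _ /=.
have -> : (fun n => \sum_(k < n) t ^+ k / (k`!)%:R * (b i * iter k (gen c) (F i) eta))
  = (fun n => b i * \sum_(k < n) t ^+ k / (k`!)%:R * iter k (gen c) (F i) eta).
  by apply/funext => n; rewrite mulr_sumr; apply: eq_bigr => k _; ring.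
apply: cvgM; [exact: cvg_cst|exact: is_cvg_semigroup].
Qed.

(** The operator [1 + s L]. Unlike the terms of the exponential series, it preserves positivity when
    [s] is small and the off-diagonal rates are nonnegative. *)
Definition euler_step (s : R) f : config N -> R := fun eta => f eta + s * gen c f eta.

(** The binomial expansion of [(1 + s L)^n], by Pascal's rule. *)
Lemma iter_euler_step (s : R) f (n : nat) eta :
  iter n (euler_step s) f eta
  = \sum_(k < n.+1) 'C(n, k)%:R * s ^+ k * iter k (gen c) f eta.
Proof.
elim: n eta => [|n IHn] eta; first by rewrite big_ord1 bin0 !mul1r.
rewrite iterS /euler_step IHn (eq_gen (fun xi _ => IHn xi)) gen_sum.
rewrite [in RHS]big_ord_recl /= bin0.
under [in RHS]eq_bigr do rewrite /bump /= add1n binS natrD !mulrDl.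
rewrite big_split /= addrA; congr (_ + _); last first.
  by rewrite mulr_sumr; apply: eq_bigr => k _; rewrite exprS; ring.
transitivity (\sum_(k < n.+2) 'C(n, k)%:R * s ^+ k * iter k (gen c) f eta).
  by rewrite [RHS]big_ord_recr /= bin_small // !mul0r addr0.
by rewrite big_ord_recl /= bin0.
Qed.

Lemma cvg_euler_semigroup f (t : R) eta : 0 <= t ->
  (iter n.+1 (euler_step (t / n.+1%:R)) f eta @[n --> \oo] --> semigroup c t f eta)%classic.
Proof.
move=> t0; have [M M0 fM] := iter_gen_bounded f eta.
under eq_fun do rewrite iter_euler_step.
exact: cvg_compound_exp_series fM (rate_bound_ge0 _) M0 t0.
Qed.

End Generator.

(** * Positivity, monotonicity in time and the limit at infinity *)

Section AbsorbingChain.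
Variables (R : realType) (N : nat) (c : config N -> config N -> R).
(** This will be [in_Omega Lam] for the consistent process and [walker_space Lam] for the
    independent walkers; signs and closure of the rates are known there. *)
Variable W : config N -> Prop.
Implicit Types (f g : config N -> R) (eta xi : config N).
Hypothesis c_ge0 : forall eta xi, W eta -> xi != eta -> 0 <= c eta xi.
Hypothesis W_closed : forall eta xi, W eta -> c eta xi != 0 -> W xi.

(** Only the outflow from [eta] is negative in [L f], so [L f >= - rate_bound c m * f] at [eta], and
    a small step keeps the factor [1 - s * rate_bound c m] nonnegative. *)
Lemma euler_step_ge0 (m : nat) (s : R) f :
  0 <= s -> s * rate_bound c m <= 1 ->
  (forall xi, W xi -> total xi = m -> 0 <= f xi) ->
  forall eta, W eta -> total eta = m -> 0 <= euler_step c s f eta.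
Proof.
move=> s0 s1 f0 eta Weta etam; have feta := f0 _ Weta etam.
have gen_ge : - (rate_bound c m * f eta) <= gen c f eta.
  apply: (@le_trans _ _ (- ((\sum_(xi <- mass_configs N m) `|c eta xi|) * f eta))).
    rewrite lerN2 ler_wpM2r // -etam; apply: (le_trans _ (sum_rate_le c eta)).
    by rewrite ler_peMl ?ler1n // sumr_ge0.
  rewrite mulr_suml -sumrN /gen etam big_seq [leRHS]big_seq; apply: ler_sum => xi.
  rewrite mem_mass_configs => /eqP xim.
  have [->|xieta] := eqVneq xi eta; first by rewrite subrr mulr0 oppr_le0 mulr_ge0.
  have [->|c0] := eqVneq (c eta xi) 0; first by rewrite normr0 !mul0r oppr0.
  rewrite ger0_norm ?c_ge0 // -mulrN ler_wpM2l ?c_ge0 //.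
  by rewrite lerDr f0 //; exact: W_closed c0.
rewrite /euler_step; apply: (@le_trans _ _ (f eta * (1 - s * rate_bound c m))).
  by rewrite mulr_ge0 // subr_ge0.
rewrite mulrBr mulr1 lerD2l; apply: le_trans (ler_wpM2l s0 gen_ge).
by rewrite le_eqVlt; apply/orP; left; apply/eqP; ring.
Qed.

Lemma iter_euler_step_ge0 (m n : nat) (s : R) f :
  0 <= s -> s * rate_bound c m <= 1 ->
  (forall xi, W xi -> total xi = m -> 0 <= f xi) ->
  forall eta, W eta -> total eta = m -> 0 <= iter n (euler_step c s) f eta.
Proof.
move=> s0 s1 f0; elim: n => [|n IHn] //.
exact: euler_step_ge0.
Qed.

Definition superharmonic (m : nat) f :=
  forall eta, W eta -> total eta = m -> gen c f eta <= 0.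

Lemma gen_euler_step (s : R) f : gen c (euler_step c s f) = euler_step c s (gen c f).
Proof.
apply/funext => eta.
transitivity (\sum_(xi <- mass_configs N (total eta)) (c eta xi * (f xi - f eta)
    + s * (c eta xi * (gen c f xi - gen c f eta)))).
  by apply: eq_bigr => xi _; rewrite /euler_step; ring.
by rewrite big_split /= -mulr_sumr.
Qed.

Lemma euler_stepB (s : R) f g :
  euler_step c s (f \- g)%R = (euler_step c s f \- euler_step c s g)%R.
Proof.
apply/funext => eta.
transitivity (f eta - g eta + s * (gen c f eta - gen c g eta)).
  congr (_ + _ * _); rewrite /gen -sumrB.
  by apply: eq_bigr => xi _ /=; ring.
by rewrite /euler_step /=; ring.
Qed.

(** Since [L] commutes with [1 + s L], this is positivity of [1 + s L] applied to [- L f]. *)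
Lemma superharmonic_euler_step (m : nat) (s : R) f :
  0 <= s -> s * rate_bound c m <= 1 ->
  superharmonic m f -> superharmonic m (euler_step c s f).
Proof.
move=> s0 s1 fs eta Weta etam; rewrite gen_euler_step -oppr_ge0.
have -> : - euler_step c s (gen c f) eta
    = euler_step c s ((fun=> 0) \- gen c f)%R eta.
  rewrite euler_stepB /=.
  suff -> : euler_step c s (fun=> 0) eta = 0 by rewrite sub0r.
  by rewrite /euler_step /gen big1 ?mulr0 ?addr0 // => xi _; rewrite subrr mulr0.
by apply: (euler_step_ge0 s0 s1) => // xi Wxi xim; rewrite /= sub0r oppr_ge0 fs.
Qed.

Lemma iter_euler_step_anti (m n : nat) (s t : R) f :
  0 <= s -> s <= t -> t * rate_bound c m <= 1 -> superharmonic m f ->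
  forall eta, W eta -> total eta = m ->
  iter n (euler_step c t) f eta <= iter n (euler_step c s) f eta.
Proof.
move=> s0 st t1 fs; have t0 := le_trans s0 st.
have s1 : s * rate_bound c m <= 1.
  by apply: le_trans t1; rewrite ler_wpM2r // rate_bound_ge0.
elim: n => [//|n IHn] eta Weta etam; rewrite !iterS.
(* The inner iterates are exchanged first, by positivity of [1 + t L]; then the outer step, by
   superharmonicity of the inner iterate. *)
apply: (@le_trans _ _ (euler_step c t (iter n (euler_step c s) f) eta)).
  rewrite -subr_ge0.
  have := @euler_step_ge0 m t (iter n (euler_step c s) f \- iter n (euler_step c t) f)%R
    t0 t1 _ eta Weta etam.
  by rewrite euler_stepB; apply => xi Wxi xim; rewrite /= subr_ge0 IHn.
have hs : superharmonic m (iter n (euler_step c s) f).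
  by elim: {IHn}n => //= n IHn; exact: superharmonic_euler_step.
by rewrite lerD2l ler_wnM2r // hs.
Qed.

Lemma near_small_step (m : nat) (t : R) :
  (\forall n \near \oo, t / n.+1%:R * rate_bound c m <= 1)%classic.
Proof.
have : ((t * n.+1%:R^-1 * rate_bound c m) @[n --> \oo] --> t * 0 * rate_bound c m)%classic.
  apply: cvgM; last exact: cvg_cst.
  by apply: cvgM; [exact: cvg_cst|exact: cvg_harmonic].
rewrite mulr0 mul0r => /cvgrPdist_le /(_ 1 ltr01).
apply: filterS => n; rewrite sub0r normrN; exact: le_trans (ler_norm _).
Qed.

Lemma semigroup_ge0 f (t : R) eta : 0 <= t ->
  (forall xi, W xi -> total xi = total eta -> 0 <= f xi) ->
  W eta -> 0 <= semigroup c t f eta.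
Proof.
move=> t0 f0 Weta; have ft := @cvg_euler_semigroup R N c f t eta t0.
rewrite -(cvg_lim _ ft) //; apply: limr_ge; first by apply/cvg_ex; eexists; exact: ft.
near=> n; apply: (@iter_euler_step_ge0 (total eta)) => //.
- by rewrite divr_ge0.
- near: n; exact: near_small_step.
Unshelve. all: by end_near. Qed.

(** The two times are compared through Euler schemes with the same number of steps, of sizes
    [s / (n + 1) <= t / (n + 1)]. *)
Lemma semigroup_anti f (s t : R) eta : 0 <= s -> s <= t ->
  superharmonic (total eta) f -> W eta ->
  semigroup c t f eta <= semigroup c s f eta.
Proof.
move=> s0 st fs Weta; have t0 := le_trans s0 st.
have ft := @cvg_euler_semigroup R N c f t eta t0.
have fs' := @cvg_euler_semigroup R N c f s eta s0.
apply: (ler_cvg_to ft fs' _).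
near=> n; apply: (@iter_euler_step_anti (total eta)) => //.
- by rewrite divr_ge0.
- by rewrite ler_wpM2r.
- near: n; exact: near_small_step.
Unshelve. all: by end_near. Qed.

Lemma is_cvg_semigroup_pinfty f eta :
  (forall xi, W xi -> total xi = total eta -> 0 <= f xi) ->
  superharmonic (total eta) f -> W eta ->
  (cvg (semigroup c t f eta @[t --> +oo%R]))%classic.
Proof.
move=> f0 fs Weta.
(* Monotonicity is known for nonnegative times, so time is truncated at 0 to get a function monotone
   on the whole line; the sign makes it nondecreasing. *)
pose h (t : R) := - semigroup c (Num.max t 0) f eta.
have hcvg : (h t @[t --> +oo%R] --> sup (range h))%classic.
  apply: nondecreasing_cvgr.
    move=> s t st; rewrite lerN2; apply: semigroup_anti => //.
      by rewrite le_max lexx orbT.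
    by rewrite ge_max !le_max lexx st orbT.
  exists 0 => _ [t _ <-]; rewrite oppr_le0; apply: semigroup_ge0 => //.
  by rewrite le_max lexx orbT.
apply/cvg_ex; exists (- sup (range h)).
apply: (cvg_trans _ (cvgN hcvg)); apply: near_eq_cvg.
near=> t; rewrite /= /h opprK max_l //.
Unshelve. all: by end_near. Qed.

End AbsorbingChain.

(** * Commutation with annihilation and the expansion of the generating function *)

Section Duality.
Variables (R : realType) (N : nat) (c : config N -> config N -> R).
Variable W : config N -> Prop.
Implicit Types (f g : config N -> R) (eta xi : config N).
Hypothesis c_ge0 : forall eta xi, W eta -> xi != eta -> 0 <= c eta xi.
Hypothesis W_closed : forall eta xi, W eta -> c eta xi != 0 -> W xi.
Hypothesis c_absorb : forall eta xi, W eta -> c eta xi != 0 -> (eta ord0 <= xi ord0)%N.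
Hypothesis W_down : forall eta xi, W eta -> (forall y, (xi y <= eta y)%N) -> W xi.
Hypothesis c_annih : forall f eta, W eta -> gen c (annih f) eta = annih (gen c f) eta.

Lemma W_cfg_sub eta y : W eta -> W (cfg_sub eta y).
Proof. by move=> Weta; apply: W_down Weta _ => i; rewrite ffunE leq_subr. Qed.

Lemma W_phi_subset (n : nat) (x : n.-tuple (site N)) (S : {set 'I_n}) :
  W (phi x) -> W (phi [seq tnth x i | i <- enum S]).
Proof.
move=> Wx; apply: W_down Wx _ => y; rewrite -phi_setT !phi_subsetE.
by rewrite [leqRHS](big_setID S) /= finset.setTI leq_addr.
Qed.

Lemma eq_gen_in f g eta : W eta -> (forall xi, W xi -> f xi = g xi) ->
  gen c f eta = gen c g eta.
Proof.
move=> Weta fg; apply: eq_bigr => xi _.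
have [->|c0] := eqVneq (c eta xi) 0; first by rewrite !mul0r.
by rewrite !fg //; exact: W_closed c0.
Qed.

Lemma eq_annih_in f g eta : W eta -> (forall xi, W xi -> f xi = g xi) ->
  annih f eta = annih g eta.
Proof. by move=> Weta fg; apply: eq_bigr => y _; rewrite fg //; exact: W_cfg_sub. Qed.

(** Commutation is available on [W]; the induction goes through because the generator only sees
    targets of nonzero rate, which remain in [W]. *)
Lemma iter_gen_annih f (k : nat) eta : W eta ->
  iter k (gen c) (annih f) eta = annih (iter k (gen c) f) eta.
Proof.
elim: k eta => // k IHk eta Weta.
by rewrite !iterS (eq_gen_in Weta IHk) c_annih.
Qed.

Lemma semigroup_annih f (t : R) eta : W eta ->
  semigroup c t (annih f) eta = annih (semigroup c t f) eta.
Proof.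
move=> Weta; apply: cvg_lim => //.
rewrite (_ : (fun n => _) = fun n => \sum_(y : site N) (eta y)%:R *
    \sum_(k < n) t ^+ k / (k`!)%:R * iter k (gen c) f (cfg_sub eta y)); last first.
  apply/funext => n.
  under eq_bigr do rewrite iter_gen_annih // /annih mulr_sumr.
  rewrite exchange_big /=; apply: eq_bigr => y _; rewrite mulr_sumr.
  by apply: eq_bigr => k _; ring.
apply: cvg_bigsum => y _.
by apply: cvgM; [exact: cvg_cst|exact: is_cvg_semigroup].
Qed.

Lemma semigroup_iter_annih f (t : R) (k : nat) eta : W eta ->
  semigroup c t (iter k (@annih R N) f) eta = iter k (@annih R N) (semigroup c t f) eta.
Proof.
elim: k eta => // k IHk eta Weta.
by rewrite !iterS semigroup_annih // (eq_annih_in Weta IHk).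
Qed.

Definition no_left eta : R := (eta ord0 == 0%N)%:R.

(** Site 0 never loses a particle, so a jump can only lower the indicator. *)
Lemma superharmonic_no_left (m : nat) : superharmonic c W m no_left.
Proof.
move=> eta Weta _; apply: sumr_le0 => xi _.
have [->|xieta] := eqVneq xi eta; first by rewrite subrr mulr0.
have [->|c0] := eqVneq (c eta xi) 0; first by rewrite mul0r.
rewrite mulr_ge0_le0 ?c_ge0 // subr_le0 /no_left ler_nat.
by have := c_absorb Weta c0; case: (eta ord0) => [|k]; case: (xi ord0).
Qed.

Lemma is_cvg_no_left eta : W eta ->
  (cvg (semigroup c t no_left eta @[t --> +oo%R]))%classic.
Proof.
move=> Weta; apply: (is_cvg_semigroup_pinfty c_ge0 W_closed) => //.
exact: superharmonic_no_left.
Qed.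

(** The sum over [k]-subsets is [A^(n-k) / (n-k)!], an operator on unlabelled configurations that
    commutes with the semigroup; [exp_phi0] is rewritten with it, evolved, and read back on
    labels. *)
Lemma semigroup_exp_left (n : nat) (x : n.-tuple (site N)) (z t : R) : W (phi x) ->
  semigroup c t (fun xi => z ^+ xi ord0) (phi x)
  = \sum_(k < n.+1) z ^+ (n - k) * (1 - z) ^+ k *
      \sum_(S : {set 'I_n} | #|S| == k)
        semigroup c t no_left (phi [seq tnth x i | i <- enum S]).
Proof.
move=> Wx.
pose b (k : 'I_n.+1) : R := z ^+ (n - k) * (1 - z) ^+ k / (n - k)`!%:R.
pose F (k : 'I_n.+1) := iter (n - k) (@annih R N) no_left.
have annihE h (y : n.-tuple (site N)) (k : 'I_n.+1) :
    (\sum_(S : {set 'I_n} | #|S| == k) h (phi [seq tnth y i | i <- enum S])) =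
    (n - k)`!%:R^-1 * iter (n - k) (@annih R N) h (phi y) :> R.
  have kn : (k <= n)%N by rewrite -ltnS.
  by rewrite iter_annih ?leq_subr // subKn // mulKf.
rewrite (@eq_semigroup _ _ _ _ (fun xi => \sum_(k < n.+1) b k * F k xi)).
  rewrite semigroup_sum; apply: eq_bigr => k _.
  by rewrite semigroup_iter_annih // annihE mulrA.
(* The expansion is needed at every configuration of mass [n], so an arbitrary one is labelled by
   some [y]. *)
move=> xi; rewrite total_phi size_tuple => xin.
have := phi_surj xi; rewrite xin => -[y <-]; rewrite exp_phi0.
by apply: eq_bigr => k _; rewrite (annihE no_left) mulrA.
Qed.

Lemma Gfun_phi (n : nat) (x : n.-tuple (site N)) (z : R) : W (phi x) ->
  Gfun c (phi x) z
  = \sum_(k < n.+1) z ^+ (n - k) * (1 - z) ^+ k *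
      \sum_(S : {set 'I_n} | #|S| == k) Pabs0 c (phi [seq tnth x i | i <- enum S]).
Proof.
move=> Wx; apply: cvg_lim => //.
under eq_fun do rewrite semigroup_exp_left //.
apply: cvg_bigsum => k _; apply: cvgM; first exact: cvg_cst.
apply: cvg_bigsum => S _; exact/is_cvg_no_left/W_phi_subset.
Qed.

End Duality.

(** * Independent walkers: consistency and agreement with one particle *)

Section IndependentWalkers.
Variables (R : realType) (N : nat) (c : config N -> config N -> R).
Implicit Types (f : config N -> R) (eta xi : config N) (u v y : site N).

Lemma gen_irw f eta :
  gen (rates_irw c) f eta = \sum_(u : site N) \sum_(v : site N | v != u)
     (eta u)%:R * rw_rate c u v * (f (cfg_move eta u v) - f eta).
Proof.
rewrite /gen /rates_irw; under eq_bigr do rewrite mulr_suml.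
rewrite exchange_big /=; apply: eq_bigr => u _.
under eq_bigr do rewrite mulr_suml.
rewrite exchange_big /=; apply: eq_bigr => v _.
have [->|u0] := posnP (eta u).
  by rewrite !mul0r big1 // => xi _; rewrite !mul0r.
by rewrite -(total_cfg_move v u0) (big_mass_configs1 _ _ (fun xi => f xi - f eta)).
Qed.

Lemma cfg_sub_add eta u v : (0 < eta u)%N ->
  cfg_sub (cfg_add eta v) u = cfg_add (cfg_sub eta u) v.
Proof.
move=> u0; apply/ffunP => y; rewrite !ffunE.
by have [->|_] := eqVneq y u; rewrite ?subn0 // addnBAC.
Qed.

Lemma cfg_addK eta v : cfg_sub (cfg_add eta v) v = eta.
Proof. by apply/ffunP => y; rewrite !ffunE addnK. Qed.

(** The particle removed is either the one just added at [v] or one of those of [eta]. *)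
Lemma annih_cfg_add f eta v :
  annih f (cfg_add eta v)
  = f eta + \sum_(y : site N) (eta y)%:R * f (cfg_add (cfg_sub eta y) v).
Proof.
rewrite /annih (eq_bigr (fun y => (y == v)%:R * f (cfg_sub (cfg_add eta v) y)
   + (eta y)%:R * f (cfg_add (cfg_sub eta y) v))).
  rewrite big_split /=; congr (_ + _).
  rewrite (bigD1 v) //= eqxx mul1r cfg_addK big1 ?addr0 // => y /negbTE ->.
  by rewrite mul0r.
move=> y _; rewrite ffunE natrD addrC mulrDl; congr (_ + _).
by have [->|y0] := posnP (eta y); rewrite ?mul0r // cfg_sub_add.
Qed.

(** The weight [eta y] hides the truncation of natural subtraction: it vanishes exactly when there
    is no particle at [y] to remove. *)
Lemma natr_cfg_sub eta u y :
  (eta y)%:R * (cfg_sub eta y u)%:R = (eta y)%:R * ((eta u)%:R - (y == u)%:R) :> R.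
Proof.
rewrite ffunE eq_sym; have [->|_] := eqVneq y u; last by rewrite subn0 subr0.
by have [->|u0] := posnP (eta u); rewrite ?mul0r // natrB.
Qed.

(** Commutation holds for each jump [u] to [v] separately: removing the jumping particle after its
    jump yields [cfg_sub eta u], and removing any other particle commutes with the jump. *)
Lemma irw_annih f eta :
  gen (rates_irw c) (annih f) eta = annih (gen (rates_irw c) f) eta.
Proof.
rewrite gen_irw [RHS]/annih; under [RHS]eq_bigr do rewrite gen_irw mulr_sumr.
rewrite exchange_big /=; apply: eq_bigr => u _.
under [RHS]eq_bigr do rewrite mulr_sumr.
rewrite exchange_big /=; apply: eq_bigr => v _.
transitivity (rw_rate c u v * \sum_(y : site N)
    ((eta y)%:R * (cfg_sub eta y u)%:R) *
    (f (cfg_move (cfg_sub eta y) u v) - f (cfg_sub eta y))); last first.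
  by rewrite mulr_sumr; apply: eq_bigr => y _; ring.
rewrite [_ * rw_rate c u v]mulrC -mulrA; congr (_ * _).
have [u0|u0] := posnP (eta u).
  rewrite u0 mul0r big1 // => y _.
  by rewrite [X in _ * X%:R]ffunE u0 sub0n mulr0 mul0r.
rewrite {1}/cfg_move annih_cfg_add.
under [RHS]eq_bigr do rewrite mulrBr.
rewrite sumrB mulrBr mulrDr.
have -> : (eta u)%:R * (\sum_(y : site N) (cfg_sub eta u y)%:R *
     f (cfg_add (cfg_sub (cfg_sub eta u) y) v)) =
   \sum_(y : site N) (eta y)%:R * (cfg_sub eta y u)%:R * f (cfg_move (cfg_sub eta y) u v).
  rewrite mulr_sumr; apply: eq_bigr => y _; rewrite cfg_subC mulrA; congr (_ * _).
  by rewrite !natr_cfg_sub; have [->|_] := eqVneq y u; rewrite ?subr0 1?mulrC.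
(* The correction at [y = u] is the contribution of the jumping particle on the other side. *)
have -> : \sum_(y : site N) (eta y)%:R * (cfg_sub eta y u)%:R * f (cfg_sub eta y) =
   (eta u)%:R * annih f eta - (eta u)%:R * f (cfg_sub eta u).
  rewrite /annih mulr_sumr (bigD1 u) //= [in RHS](bigD1 u) //= natr_cfg_sub eqxx.
  rewrite (eq_bigr (fun y => (eta u)%:R * ((eta y)%:R * f (cfg_sub eta y)))).
    by rewrite [RHS]addrAC; congr (_ + _); rewrite mulr1n; ring.
  by move=> y /negbTE yu; rewrite natr_cfg_sub yu subr0; ring.
by ring.
Qed.

Lemma phi1 u : phi [:: u] = delta u.
Proof. by apply/ffunP => y; rewrite !ffunE /= addn0 eq_sym. Qed.

Lemma total0 eta : total eta = 0%N -> eta = phi [::].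
Proof.
have [x] := phi_surj eta; move: x; case: (total eta) => // x <- _.
by rewrite tuple0.
Qed.

Lemma total1 eta : total eta = 1%N -> exists u, eta = delta u.
Proof.
move=> e1; have := phi_surj eta; rewrite e1 => -[[[|u [|v s]] // sx] <-].
by exists u; rewrite -phi1.
Qed.

Lemma delta_inj : injective (@delta N).
Proof.
move=> u v /ffunP /(_ u); rewrite !ffunE eqxx.
by case: eqVneq.
Qed.

(** The walker rates are built from the one-particle rates of [c], so off the diagonal both agree;
    on the diagonal the difference of [f] is zero. *)
Lemma gen_irw_single f eta : (total eta <= 1)%N ->
  gen c f eta = gen (rates_irw c) f eta.
Proof.
move=> eta1; apply: eq_big_seq => xi; rewrite mem_mass_configs => /eqP xim.
have [->|xieta] := eqVneq xi eta; first by rewrite subrr !mulr0.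
congr (_ * _); case: (posnP (total eta)) => [e0|e0].
  by move: xieta; rewrite [eta]total0 // [xi]total0 ?xim // eqxx.
have e1 : total eta = 1%N by apply/eqP; rewrite eqn_leq eta1 e0.
have [u eu] := total1 e1; have [v xv] := total1 (etrans xim e1).
subst eta xi; have vu : v != u by apply: contraNneq xieta => ->.
rewrite /rates_irw (bigD1 u) //= [X in _ + X]big1 ?addr0; last first.
  by move=> w /negbTE wu; rewrite big1 // => w' _; rewrite ffunE wu !mul0r.
rewrite (bigD1 v) //= cfg_move_delta eqxx mulr1 ffunE eqxx mul1r.
rewrite big1 ?addr0 // => w /andP[_ wv].
by rewrite cfg_move_delta (inj_eq delta_inj) [v == w]eq_sym (negbTE wv) mulr0.
Qed.

Lemma Pabs0_irw_single eta : (total eta <= 1)%N ->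
  Pabs0 c eta = Pabs0 (rates_irw c) eta.
Proof.
move=> eta1; rewrite /Pabs0 /semigroup.
suff E k xi : total xi = total eta ->
  iter k (gen c) (fun xi => (xi ord0 == 0%N)%:R) xi
  = iter k (gen (rates_irw c)) (fun xi => (xi ord0 == 0%N)%:R) xi :> R.
  by under eq_fun do under eq_fun do under eq_bigr do rewrite E //.
elim: k xi => // k IHk xi xim.
by rewrite !iterS gen_irw_single ?xim //; apply: eq_gen => xi' xi'm; rewrite IHk ?xi'm.
Qed.

Lemma rates_irw_neq0 eta xi : rates_irw c eta xi != 0 ->
  exists u v, [/\ v != u, (0 < eta u)%N, rw_rate c u v != 0 & xi = cfg_move eta u v].
Proof.
move=> nz; apply: contrapT => no; move/eqP: nz; apply.
rewrite /rates_irw big1 // => u _; rewrite big1 // => v vu.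
have [->|u0] := posnP (eta u); first by rewrite !mul0r.
have [->|ruv] := eqVneq (rw_rate c u v) 0; first by rewrite mulr0 mul0r.
have [E|_] := eqVneq xi (cfg_move eta u v); last by rewrite mulr0.
by case: no; exists u, v.
Qed.

End IndependentWalkers.

(** * State spaces and absorption for the two processes *)

Section BulkAndReservoirs.
Variables (R : realType) (N : nat) (Lam : pred nat).
Variables (cL : config N -> config N -> R) (r : site N -> site N -> R).
Implicit Types (eta xi : config N).
Hypothesis Lam_down : forall k : nat, Lam k.+1 -> Lam k.
Hypothesis r_ge0 : forall i j, 0 <= r i j.
Hypothesis cL_bulk : bulk_generator Lam cL.

Lemma in_Omega_down eta xi :
  in_Omega Lam eta -> (forall y, bulk y -> (xi y <= eta y)%N) -> in_Omega Lam xi.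
Proof.
move=> etaO le_xi i bi; have le_i := le_xi i bi.
move: (etaO i bi); rewrite -(subnKC le_i); elim: (_ - _)%N => [|k IHk].
  by rewrite addn0.
by rewrite addnS => /Lam_down.
Qed.

Lemma rates_abs_ge0 eta xi :
  in_Omega Lam eta -> xi != eta -> 0 <= rates_abs cL r eta xi.
Proof.
have [cL0 _ _] := cL_bulk; move=> etaO ne; rewrite addr_ge0 ?cL0 //.
rewrite /rates_H; apply: sumr_ge0 => i _; apply: sumr_ge0 => j _.
by rewrite !mulr_ge0.
Qed.

(** The bulk part freezes the absorbing sites, and a reservoir jump takes a particle from the bulk
    to an absorbing site, which lowers bulk occupations and never empties site 0. *)
Lemma rates_abs_neq0 eta xi : in_Omega Lam eta -> rates_abs cL r eta xi != 0 ->
  in_Omega Lam xi /\ (eta ord0 <= xi ord0)%N.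
Proof.
have [_ cL1 _] := cL_bulk; move=> etaO nz.
have [cL_0|/(cL1 _ _ etaO)[xi_abs _ xiO]] := eqVneq (cL eta xi) 0; last first.
  by rewrite xi_abs.
apply: contrapT => no; move/eqP: nz; apply.
rewrite /rates_abs cL_0 add0r /rates_H big1 // => i bi; rewrite big1 // => j aj.
have [E|_] := eqVneq xi (cfg_move eta i j); last by rewrite mulr0.
case: no; rewrite E; split.
  apply: in_Omega_down etaO _ => y by_.
  have yj : (y == j) = false by apply: contraTF by_ => /eqP ->.
  by rewrite !ffunE yj addn0 leq_subr.
have i0 : (ord0 == i) = false by apply: contraTF bi => /eqP <-.
by rewrite !ffunE i0 subn0 leq_addr.
Qed.

(* Independent walkers may violate the occupancy constraint [Lam]; it is enough
   that each of their one-particle configurations satisfies it. *)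
Definition walker_space eta := forall u, (0 < eta u)%N -> in_Omega Lam (delta u).

Lemma walker_space_in_Omega eta : in_Omega Lam eta -> walker_space eta.
Proof.
move=> etaO u u0; apply: in_Omega_down etaO _ => y _; rewrite ffunE.
by have [->|_] := eqVneq y u.
Qed.

Lemma walker_space_down eta xi :
  walker_space eta -> (forall y, (xi y <= eta y)%N) -> walker_space xi.
Proof. by move=> etaW le_xi u u0; apply: etaW; exact: leq_trans (le_xi u). Qed.

Lemma rates_irw_ge0 eta xi : walker_space eta -> xi != eta ->
  0 <= rates_irw (rates_abs cL r) eta xi.
Proof.
move=> etaW _; apply: sumr_ge0 => u _; apply: sumr_ge0 => v vu.
have [->|u0] := posnP (eta u); first by rewrite !mul0r.
rewrite !mulr_ge0 // rates_abs_ge0 //; first exact: etaW.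
by rewrite (inj_eq (@delta_inj N)).
Qed.

(** A walker jump from [u] to [v] of nonzero rate is a transition of the consistent process from
    [delta u], whose properties give both that [delta v] is admissible and that a walker at 0 stays
    there. *)
Lemma rates_irw_abs_neq0 eta xi : walker_space eta ->
  rates_irw (rates_abs cL r) eta xi != 0 ->
  walker_space xi /\ (eta ord0 <= xi ord0)%N.
Proof.
move=> etaW /rates_irw_neq0[u [v [vu u0 ruv ->]]].
have [vO le0] := rates_abs_neq0 (etaW u u0) ruv; split.
  move=> y; rewrite !ffunE; have [-> //|_] := eqVneq y v.
  by rewrite addn0 => y0; apply: etaW; exact: leq_trans y0 (leq_subr _ _).
move: le0; rewrite !ffunE.
have [_|_] := eqVneq ord0 u; last by rewrite subn0 leq_addr.
by case: (ord0 == v) => //= _; rewrite subn1 addn1 leqSpred.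
Qed.

End BulkAndReservoirs.

(** * Cancellation of the lowest terms and the final identity *)

Lemma big_ord_from2 (V : nmodType) (F : nat -> V) (n : nat) :
  (forall k, (k < 2)%N -> F k = 0) ->
  \sum_(k < n.+1) F k = \sum_(2 <= k < n.+1) F k.
Proof.
move=> F0; rewrite -(big_mkord xpredT F) big_ltn // F0 // add0r.
case: n => [|n]; first by rewrite !big_geq.
by rewrite big_ltn // F0 // add0r.
Qed.

Theorem theorem5p9 (R : realType) (N : nat) (Lam : pred nat)
  (cL : config N -> config N -> R) (r : site N -> site N -> R)
  (hLam : forall k : nat, Lam k.+1 -> Lam k)
  (hr : forall i j, 0 <= r i j)
  (hL : bulk_generator Lam cL)
  (hcons : consistent Lam (rates_abs cL r))
  (n : nat) (x : n.-tuple (site N)) (z : R)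
  (hx : in_Omega Lam (phi x)) (hz : 0 <= z) :
  let c := rates_abs cL r in
  let cirw := rates_irw c in
  let Gcal eta z := Gfun c eta z - Gfun cirw eta z in
  let Gcal0 eta := Pabs0 c eta - Pabs0 cirw eta in
  Gcal (phi x) z =
  \sum_(2 <= k < n.+1) z ^+ (n - k) * (1 - z) ^+ k *
     \sum_(S : {set 'I_n} | #|S| == k) Gcal0 (phi [seq tnth x i | i <- enum S]).
Proof.
move=> c cirw Gcal Gcal0.
have GE := Gfun_phi (rates_abs_ge0 hr hL)
  (fun eta xi etaO nz => (rates_abs_neq0 hLam hL etaO nz).1)
  (fun eta xi etaO nz => (rates_abs_neq0 hLam hL etaO nz).2)
  (fun eta xi etaO le_xi => in_Omega_down hLam etaO (fun y _ => le_xi y)) hcons z hx.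
(* The same expansion for the walkers, now on [walker_space], which contains the admissible starting
   configuration. *)
have GirwE := Gfun_phi (rates_irw_ge0 hr hL)
  (fun eta xi etaW nz => (rates_irw_abs_neq0 hLam hL etaW nz).1)
  (fun eta xi etaW nz => (rates_irw_abs_neq0 hLam hL etaW nz).2)
  (@walker_space_down N Lam) (fun f eta _ => irw_annih _ f eta) z
  (walker_space_in_Omega hLam hx).
rewrite /Gcal GE GirwE -sumrB.
pose T k := z ^+ (n - k) * (1 - z) ^+ k *
     \sum_(S : {set 'I_n} | #|S| == k) Gcal0 (phi [seq tnth x i | i <- enum S]).
(* A set of fewer than two labels gives at most one particle, where the two absorption probabilities
   coincide. *)
have T0 k : (k < 2)%N -> T k = 0.
  move=> k2; rewrite /T big1 ?mulr0 // => S /eqP cS.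
  rewrite /Gcal0 Pabs0_irw_single ?subrr //.
  by rewrite total_phi size_map -cardE cS -ltnS.
transitivity (\sum_(k < n.+1) T k).
  by apply: eq_bigr => k _; rewrite -mulrBr -sumrB.
by rewrite big_ord_from2.
Qed.
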